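(* Let $T$ be a set of $n$ teams with strengths $s_i\in\mathbb{N}$ ($i\in T$), with $n$ even, partitioned into two pots $R$ and $B$ of $n/2$ teams each, and let every team have to play $k=2$ matches. There exists a fair draw in which every team plays exactly one match against a team from each of the two pots if and only if every connected component of $G_p$ has a perfect matching and $n$ is a multiple of $4$.
   Context: A draw (for $k$ matches per team, $1\le k\le n-1$) is a set of $nk/2$ matches, i.e. unordered pairs of distinct teams, such that each team occurs in exactly $k$ matches. The opponent set of a team is the set of the $k$ teams it plays against. The strength of an opponent set is the average strength of its teams. A draw is fair if the strengths of all $n$ opponent sets are equal. Each team plays one opponent from its own pot and one from the other pot. Let $\bar s=\frac1n\sum_{i\in T}s_i$. The opponent graph $G=(V,E)$ has $V=T$ and $E=\{\{i,j\}: i\neq j,\ \tfrac12(s_i+s_j)=\bar s\}$. The graph $G_p$ is the subgraph of $G$ with vertex set $T$ and edge set $E_p=E\cap\{\{i,j\}: i\in R, j\in B \text{ or } i\in B, j\in R\}$. *)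

(* Defs.v *)
From HB Require Import structures.
From mathcomp Require Import all_boot all_order all_algebra.

Set Implicit Arguments.
Unset Strict Implicit.
Unset Printing Implicit Defensive.

Import GRing.Theory.
Local Open Scope ring_scope.

Section Draws.

Variable T : finType.
Implicit Types (s : T -> nat) (k : nat) (M E N : {set {set T}}).
Implicit Types (A C R B : {set T}) (i j : T).

(* A match is a two-element set of teams; a draw is a set of matches. *)
Definition is_draw k M : Prop :=
  [/\ forall m, m \in M -> #|m| = 2%N,
      (#|M| * 2 = #|T| * k)%N
    & forall i, #|[set m in M | i \in m]| = k].

Definition opponents M i : {set T} :=
  [set j | (j != i) && ([set i; j] \in M)].

Definition strength s A : rat := (\sum_(i in A) (s i)%:R) / #|A|%:R.

Definition fair s M : Prop :=
  forall i j, strength s (opponents M i) = strength s (opponents M j).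

Definition one_match_per_pot R B M : Prop :=
  forall i, #|opponents M i :&: R| = 1%N /\ #|opponents M i :&: B| = 1%N.

(* Graphs have vertex set T and are represented by their set of edges, an     *)
(* edge being a two-element set of vertices.                                  *)

Definition opponent_graph s : {set {set T}} :=
  [set [set i; j] | i in T, j in T &
     (i != j) && (((s i)%:R + (s j)%:R) / 2 == strength s [set: T])].

Definition pot_graph s R B : {set {set T}} :=
  opponent_graph s :&:
  [set [set i; j] | i in T, j in T &
     (i \in R) && (j \in B) || (i \in B) && (j \in R)].

Definition adjacent E : rel T := [rel i j | (i != j) && ([set i; j] \in E)].

(* The components are given by their vertex sets; isolated vertices count. *)
Definition components E : {set {set T}} :=
  [set [set j | connect (adjacent E) i j] | i : T].

Definition induced_subgraph E C : {set {set T}} := [set e in E | e \subset C].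

(* N is a perfect matching of the subgraph of E induced by C. *)
Definition is_perfect_matching E C N : Prop :=
  N \subset induced_subgraph E C /\
  forall i, i \in C -> #|[set e in N | i \in e]| = 1%N.

Definition has_perfect_matching E C : Prop :=
  exists N, is_perfect_matching E C N.

End Draws.

(* Main.v *)
(* A draw with one match per pot amounts to two involutions: f (the opponent  *)
(* from the own pot) and g (the opponent from the other pot).  It is fair     *)
(* exactly when s (f i) + s (g i) is constant, and summing over i shows that  *)
(* this constant is twice the mean strength.  So in a fair draw the two       *)
(* opponents of every team are joined in the pot graph, and the opponent      *)
(* pairs of the teams of R form a perfect matching of that graph; moreover f  *)
(* pairs off the teams of R, so that #|R| = n / 2 is even.  Conversely, if p  *)
(* is a perfect matching of the pot graph and q pairs off the teams of R,     *)
(* then f = q on R, f = p q p on B, and g = p f define a fair draw.           *)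

Require Import Defs.
From HB Require Import structures.
From mathcomp Require Import all_boot all_order all_algebra.
From mathcomp Require Import zify lra.

Set Implicit Arguments.
Unset Strict Implicit.
Unset Printing Implicit Defensive.

Import GRing.Theory Num.Theory.

(** By [components_perfect_matchings], matchings of the separate components amount to one involution
    [p] sending every team to a neighbour in the pot graph; since [R] holds half of the teams,
    [4 %| n] says that [#|R|] is even. It remains to pass between such a [p] and the involutions
    [f], [g] of a fair draw. [fair_draw_pot_matching] composes [f] and [g] into [p], with
    [fair_strength] supplying the mean; [pot_matching_fair_draw] builds [f] and [g] from [p] and a
    pairing of [R]. *)

Section Pairs.

Variable T : finType.
Implicit Types (i j k : T) (e A C : {set T}) (E M N : {set {set T}}).

(** * Unordered pairs and involutions *)

Lemma set2_injr i : injective (fun j => [set i; j]).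
Proof.
move=> j k /setP eq_jk; have := eq_jk j; have := eq_jk k.
rewrite !inE !eqxx !orbT.
by case: eqVneq => [->|_ /= /eqP->//]; case: eqVneq => [->|_ _ /eqP].
Qed.

Lemma card_set2I i j A :
  (i \in A) != (j \in A) -> #|[set i; j] :&: A| = 1.
Proof.
have set1I k : [set k] :&: A = if k \in A then [set k] else set0.
  apply/setP=> x; case: ifP => kA; rewrite !inE; case: eqVneq => // -> //.
by rewrite setIUl !set1I; do 2!case: ifP; rewrite ?setU0 ?set0U ?cards1.
Qed.

Lemma card2_mem e i :
  #|e| = 2 -> i \in e -> exists2 j, j != i & e = [set i; j].
Proof.
move=> /eqP/cards2P[x [y [neq_xy ->]]]; rewrite !inE => /orP[]/eqP->.
  by exists y; rewrite // eq_sym.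
by exists x; rewrite // setUC.
Qed.

(** By symmetry every [i] is a partner of its own partner, and by uniqueness the only one. This
    turns degree conditions, on matchings and on draws, into involutions. *)
Lemma unique_partner (r : rel T) :
  symmetric r -> (forall i, #|[set j | r i j]| = 1) ->
  exists2 f, involutive f & forall i j, r i j = (j == f i).
Proof.
move=> rC r1; have ex i : exists j, r i j.
  by move/eqP/cards1P: (r1 i) => [j /setP/(_ j)]; rewrite !inE eqxx; exists j.
have rE i j : r i j = (j == xchoose (ex i)).
  have := xchooseP (ex i); set x := xchoose _ => rix.
  move/eqP/cards1P: (r1 i) => [y /setP rE].
  have := rE j; have := rE x; rewrite !inE rix => /esym/eqP xE ->.
  by rewrite xE.
exists (fun i => xchoose (ex i)) => // i.
by apply/esym/eqP; rewrite -rE rC rE.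
Qed.

Lemma incident_pairs f A i : involutive f -> i \in A ->
  [set e in [set [set j; f j] | j in A] | i \in e] = [set [set i; f i]].
Proof.
move=> fK iA; apply/setP=> e; rewrite !inE; apply/andP/eqP => [[]|->].
  case/imsetP=> j jA ->; rewrite !inE => /orP[/eqP->//|/eqP->].
  by rewrite fK setUC.
by rewrite !inE eqxx; split=> //; apply/imsetP; exists i.
Qed.

Lemma mem_pairs f i j : involutive f ->
  ([set i; j] \in [set [set x; f x] | x : T]) = (j == f i).
Proof.
move=> fK; apply/imsetP/eqP => [[x _ eq_e]|->]; last by exists i.
have : i \in [set x; f x] by rewrite -eq_e !inE eqxx.
rewrite !inE => /orP[/eqP xi|/eqP ifx].
  by move: eq_e; rewrite -xi => /set2_injr.
by move: eq_e; rewrite ifx fK [RHS]setUC => /set2_injr.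
Qed.

(** Each orbit [{i, f i}] has exactly one member of smaller rank. These members form [A'], and [f]
    maps [A'] bijectively onto the rest of [A]. *)
Lemma even_card_involution f A : involutive f -> (forall i, f i != i) ->
  {in A, forall i, f i \in A} -> ~~ odd #|A|.
Proof.
move=> fK fN fA; pose A' := [set i in A | enum_rank i < enum_rank (f i)].
suff -> : #|A| = #|A'| + #|A'| by rewrite addnn odd_double.
have A'f : [set f i | i in A'] = A :\: A'.
  apply/setP=> i; rewrite !inE; apply/imsetP/andP => [[j]|[]].
    rewrite !inE => /andP[jA lt_j] ->; rewrite fK fA //; split=> //=.
    by rewrite -leqNgt ltnW.
  move=> + iA; rewrite iA /= -leqNgt => le_i; exists (f i); last by rewrite fK.
  rewrite !inE fA //= fK ltn_neqAle le_i andbT.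
  by apply: contra (fN i) => /eqP/val_inj/enum_rank_inj->.
rewrite -{2}(card_imset (mem A') (inv_inj fK)) A'f -{1}(cardsID A' A).
congr (#|pred_of_set _| + _); apply/setIidPr/subsetP=> i.
by rewrite inE => /andP[].
Qed.

(* Positions 2m and 2m + 1 of an enumeration of A are swapped. *)
Lemma pairing_of_even_card A : ~~ odd #|A| ->
  exists f : T -> T, {in A, forall i, [/\ f i \in A, f i != i & f (f i) = i]}.
Proof.
move=> evA; pose sw (m : nat) := if odd m then m.-1 else m.+1.
(* The default [i] only supplies an inhabitant of [T]: for [i] in [A] all positions stay in range,
   so the different defaults inside [f (f i)] agree. *)
exists (fun i => nth i (enum A) (sw (index i (enum A)))) => i iA.
have lt_i : index i (enum A) < size (enum A) by rewrite index_mem mem_enum.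
have szA : ~~ odd (size (enum A)) by rewrite -cardE.
(* An even position below an even size is not the last one, so its successor is in range. *)
have ltsw : sw (index i (enum A)) < size (enum A).
  by rewrite /sw; case: ifP; lia.
split; first by rewrite -mem_enum mem_nth.
  rewrite -{3}(@nth_index _ i i (enum A)) ?mem_enum //.
  rewrite nth_uniq ?enum_uniq // /sw; case: ifP; lia.
rewrite index_uniq ?enum_uniq //.
have -> : sw (sw (index i (enum A))) = index i (enum A).
  by rewrite {2}/sw /sw; case: ifP; case: ifP; lia.
by rewrite (set_nth_default i) // nth_index // mem_enum.
Qed.

Lemma incident_opponents M i : (forall m, m \in M -> #|m| = 2) ->
  [set m in M | i \in m] = [set [set i; j] | j in opponents M i].
Proof.
move=> M2; apply/setP=> m; rewrite inE; apply/andP/imsetP => [[mM im]|[j]].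
  have [j ji mE] := card2_mem (M2 _ mM) im.
  by exists j; rewrite // inE ji -mE.
by rewrite inE => /andP[_ ijM] ->; rewrite ijM !inE eqxx.
Qed.

(** The matches of [i] correspond to its opponents. Counting incidences of teams with matches in two
    ways then gives the number of matches. *)
Lemma is_draw_opponents (k : nat) M : (forall m, m \in M -> #|m| = 2) ->
  (forall i, #|opponents M i| = k) -> is_draw k M.
Proof.
move=> M2 Mk; have deg i : #|[set m in M | i \in m]| = k.
  by rewrite incident_opponents // card_imset //; apply: set2_injr.
split=> //; rewrite -sum_nat_const -(eq_bigr _ M2).
rewrite -sum_nat_const -[RHS](eq_bigr _ (fun i _ => deg i)).
under eq_bigr do rewrite -sum1_card big_mkcond.
rewrite exchange_big; apply: eq_bigr => i _; rewrite -sum1_card.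
by rewrite -big_mkcondr; apply: eq_bigl => m; rewrite inE.
Qed.

(** * Components and perfect matchings *)

Lemma adjacentC E : symmetric (adjacent E).
Proof. by move=> i j; rewrite /adjacent /= eq_sym setUC. Qed.

(** An edge [{i, p i}] never leaves a component, so [p] restricts to each of them. Conversely, one
    matching is chosen per component, and every vertex takes its partner from the matching of its
    own component. *)
Lemma components_perfect_matchings E : (forall e, e \in E -> #|e| = 2) ->
  (forall C, C \in components E -> has_perfect_matching E C) <->
  (exists2 p, involutive p & forall i, adjacent E i (p i)).
Proof.
move=> E2; have cC := sym_connect_sym (@adjacentC E).
pose comp i := [set j | connect (adjacent E) i j].
have compE i j : j \in comp i -> comp j = comp i.
  rewrite inE cC => ji; apply/setP=> k.
  by rewrite !inE (same_connect cC ji).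
split=> [pmE|[p pK Ep] _ /imsetP[x _ ->]]; last first.
  exists [set [set j; p j] | j in comp x]; split=> [|i ix]; last first.
    by rewrite (incident_pairs pK ix) cards1.
  apply/subsetP=> _ /imsetP[i ix ->]; have /andP[_ eE] := Ep i.
  rewrite inE eE /=; apply/subsetP=> j; rewrite !inE => /orP[]/eqP->.
    by move: ix; rewrite inE.
  by move: ix; rewrite inE => /connect_trans; apply; apply: connect1.
(* The boolean form [pm] allows the choice by [pick]. The choice depends only on the vertex set [C],
   so vertices of one component share their matching, which makes [r] symmetric. The default [set0]
   does not arise for components. *)
pose pm C N := (N \subset induced_subgraph E C) &&
  [forall i in C, #|[set e in N | i \in e]| == 1].
pose NC C := odflt set0 [pick N | pm C N].
have NCP i : is_perfect_matching E (comp i) (NC (comp i)).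
  rewrite /NC; case: pickP => [N /andP[NE /forall_inP N1]|noN].
    by split=> // j /N1/eqP.
  have [|N [NE N1]] := pmE (comp i); first by apply: imset_f.
  by case/andP: (noN N); split=> //; apply/forall_inP=> j /N1 ->.
pose r := [rel i j | (j != i) && ([set i; j] \in NC (comp i))].
have NCE i e : e \in NC (comp i) -> e \in E /\ e \subset comp i.
  have [/subsetP NE _] := NCP i.
  by move=> /NE; rewrite inE => /andP[].
have [|i|p pK rE] := @unique_partner r.
- suff rC i j : r i j -> r j i by move=> i j; apply/idP/idP; apply: rC.
  case/andP=> ji eN; have [_ /subsetP eC] := NCE _ _ eN.
  by rewrite /= eq_sym ji (@compE i) ?eC ?inE ?eqxx ?orbT //= setUC.
- have [_ /(_ i)] := NCP i; rewrite inE connect0 => /(_ isT) <-.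
  rewrite -(card_imset _ (@set2_injr i)); apply: eq_card => e.
  apply/imsetP/idP => [[j]|]; rewrite !inE.
    by case/andP=> _ eN ->; rewrite eN !inE eqxx.
  case/andP=> eN ie; have [j ji eE] := card2_mem (E2 _ (NCE _ _ eN).1) ie.
  by exists j; rewrite // inE /= ji -eE.
exists p => // i; have := rE i (p i); rewrite eqxx => /andP[ni /NCE[eE _]].
by rewrite /adjacent /= eq_sym ni.
Qed.

End Pairs.

(** * Fair draws and the pot graph *)

Section Pots.

Variables (T : finType) (s : T -> nat) (R : {set T}).
Implicit Types (i j : T) (M : {set {set T}}).

Local Open Scope ring_scope.

(** Both edge conditions are symmetric, so it does not matter in which order a pair is presented in
    the image sets; lying in different pots forces [i != j]. *)
Lemma adjacent_pot_graph i j : adjacent (pot_graph s R (~: R)) i j =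
  ((i \in R) != (j \in R)) &&
  (((s i)%:R + (s j)%:R) / 2 == strength s [set: T]).
Proof.
have potE x y : (x \in R) && (y \in ~: R) || (x \in ~: R) && (y \in R)
  = ((x \in R) != (y \in R)) by rewrite !inE; do 2!case: (_ \in R).
have set2E x y : [set i; j] = [set x; y] -> x = i /\ y = j \/ x = j /\ y = i.
  move=> eq_e; have : x \in [set i; j] by rewrite eq_e !inE eqxx.
  rewrite !inE => /orP[]/eqP xE; [left|right]; move: eq_e; rewrite xE.
    by move/set2_injr.
  by rewrite setUC => /set2_injr.
rewrite /adjacent /= /pot_graph inE.
apply/and3P/andP => [[nij /imset2P[x y _]]|[pot avg]].
  rewrite inE => /and3P[_ _ avg] eqxy /imset2P[z t _].
  rewrite inE potE => /andP[_ pot] eqzt; split.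
    by case: (set2E _ _ eqzt) pot => [] [-> ->] //; rewrite eq_sym.
  by case: (set2E _ _ eqxy) avg => [] [-> ->] //; rewrite addrC.
have nij : i != j by apply: contraNneq pot => ->.
split=> //; first by apply/imset2P; exists i j; rewrite ?inE ?nij.
by apply/imset2P; exists i j; rewrite // inE potE.
Qed.

Lemma card_pot_edge e : e \in pot_graph s R (~: R) -> #|e| = 2%N.
Proof.
rewrite inE => /andP[/imset2P[i j _]]; rewrite inE => /and3P[_ nij _] -> _.
by rewrite cards2 nij.
Qed.

Lemma one_match_per_pot_partners M : one_match_per_pot R (~: R) M ->
  exists f g : T -> T, [/\ involutive f, involutive g,
    forall i, (f i \in R) = (i \in R), forall i, (g i \in R) = (i \notin R)
    & forall i, opponents M i = [set f i; g i]].
Proof.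
move=> M1; have oppC i j : (j \in opponents M i) = (i \in opponents M j).
  by rewrite !inE eq_sym setUC.
(* The boolean [b] selects the opponent in the own pot ([false]) or in the other pot ([true]). *)
pose r b := [rel i j | (j \in opponents M i) && ((j \in R) == b (+) (i \in R))].
have rC b : symmetric (r b).
  by move=> i j; rewrite /= oppC; case: b; do 2!case: (_ \in R).
have r1 b i : #|[set j | r b i j]| = 1%N.
  have [MR MB] := M1 i.
  case bi: (b (+) (i \in R)); [rewrite -[RHS]MR | rewrite -[RHS]MB];
    apply: eq_card => j; rewrite !inE /= bi //; by case: (j \in R).
have [f fK fE] := unique_partner (rC false) (r1 false).
have [g gK gE] := unique_partner (rC true) (r1 true).
exists f, g; split=> // [i|i|i].
- by have := fE i (f i); rewrite eqxx => /andP[_ /eqP].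
- by have := gE i (g i); rewrite eqxx => /andP[_ /eqP].
apply/setP=> j; rewrite in_set2 -fE -gE /=.
by case: (j \in opponents M i); do 2!case: (_ \in R).
Qed.

Lemma strength2 i j : i != j -> strength s [set i; j] = ((s i)%:R + (s j)%:R) / 2.
Proof. by move=> nij; rewrite /strength cards2 nij big_setU1 ?inE ?big_set1. Qed.

(** Since [f] and [g] permute the teams, the strengths of all opponent sets add up to the sum of all
    [s j]; equal summands must therefore equal the mean. *)
Lemma fair_strength M (f g : T -> T) : involutive f -> involutive g ->
  (forall i, f i != g i) -> (forall i, opponents M i = [set f i; g i]) ->
  fair s M -> forall i, strength s (opponents M i) = strength s [set: T].
Proof.
move=> fK gK nfg oppE fairM i.
have : \sum_j strength s (opponents M j) = \sum_j (s j)%:R.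
  under eq_bigr do rewrite oppE strength2 // mulrDl.
  rewrite big_split /= -!mulr_suml.
  have sumE h : involutive h -> \sum_j (s (h j))%:R = \sum_j (s j)%:R :> rat.
    by move=> hK; rewrite [RHS](reindex_inj (inv_inj hK)).
  by rewrite !sumE //; lra.
under eq_bigr do rewrite (fairM _ i).
rewrite sumr_const -mulr_natr /strength => sumE.
rewrite [in RHS]cardsT; under [in RHS]eq_bigl do rewrite inE.
by rewrite -sumE mulfK // pnatr_eq0 -lt0n; apply/card_gt0P; exists i.
Qed.

Lemma fair_draw_pot_matching M :
  fair s M -> one_match_per_pot R (~: R) M ->
  ~~ odd #|R| /\ exists2 p, involutive p &
    forall i, adjacent (pot_graph s R (~: R)) i (p i).
Proof.
move=> fairM /one_match_per_pot_partners[f [g [fK gK fR gR oppE]]].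
have nfg i : f i != g i.
  by apply/eqP=> fg; have := fR i; rewrite fg gR; case: (_ \in R).
have avg i : ((s (f i))%:R + (s (g i))%:R) / 2 = strength s [set: T].
  by rewrite -strength2 // -oppE; apply: (fair_strength fK gK).
have fN i : f i != i.
  by have := set21 (f i) (g i); rewrite -oppE inE => /andP[].
split; first by apply: (even_card_involution fK fN) => i; rewrite fR.
(* On [R], [i] and [p i] are the two opponents of [f i]; off [R], they are those of [g i]. As [p]
   changes the pot, its two branches undo each other. *)
pose p i := if i \in R then g (f i) else f (g i).
have pR i : (p i \in R) = (i \notin R).
  by rewrite /p; case: (boolP (i \in R)) => iR; rewrite ?fR gR ?fR iR.
exists p => i.
  by rewrite {1}/p pR /p; case: (i \in R); rewrite /= (gK, fK) (gK, fK).
rewrite adjacent_pot_graph pR /p; case: (i \in R) => /=.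
  by rewrite -{1}(fK i) avg.
by rewrite -{1}(gK i) addrC avg.
Qed.

(** The matches are the pairs [{i, f i}] and [{i, g i}]. As [f] keeps the pot and [g] changes it,
    each team gets one opponent in each pot, and [g] has no fixed point. *)
Lemma involutions_fair_draw (f g : T -> T) : involutive f -> involutive g ->
  (forall i, f i != i) -> (forall i, (f i \in R) = (i \in R)) ->
  (forall i, (g i \in R) = (i \notin R)) ->
  (forall i, ((s (f i))%:R + (s (g i))%:R) / 2 = strength s [set: T]) ->
  exists M, [/\ is_draw 2 M, fair s M & one_match_per_pot R (~: R) M].
Proof.
move=> fK gK fN fR gR avg.
have nfg i : f i != g i.
  by apply/eqP=> fg; have := fR i; rewrite fg gR; case: (_ \in R).
have gN i : g i != i.
  by apply/eqP=> gi; have := gR i; rewrite gi; case: (_ \in R).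
exists ([set [set i; f i] | i : T] :|: [set [set i; g i] | i : T]).
set M := _ :|: _.
have oppE i : opponents M i = [set f i; g i].
  apply/setP=> j; rewrite !inE !mem_pairs //.
  case: (eqVneq j i) => //= ->.
  by rewrite eq_sym (negPf (fN i)) eq_sym (negPf (gN i)).
split=> [|i j|i].
- apply: is_draw_opponents => [m|i]; last by rewrite oppE cards2 nfg.
  rewrite inE => /orP[]/imsetP[i _ ->]; by rewrite cards2 eq_sym ?fN ?gN.
- by rewrite !oppE !strength2 // !avg.
by rewrite oppE; split; apply: card_set2I; rewrite ?inE fR gR; case: (i \in R).
Qed.

Lemma pot_matching_fair_draw (p : T -> T) : ~~ odd #|R| -> involutive p ->
  (forall i, adjacent (pot_graph s R (~: R)) i (p i)) ->
  exists M, [/\ is_draw 2 M, fair s M & one_match_per_pot R (~: R) M].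
Proof.
move=> evR pK adj; have [q qR] := pairing_of_even_card evR.
have pR i : (p i \in R) = (i \notin R).
  by have := adj i; rewrite adjacent_pot_graph => /andP[]; do 2!case: (_ \in R).
have avg i : ((s i)%:R + (s (p i))%:R) / 2 = strength s [set: T].
  by have := adj i; rewrite adjacent_pot_graph => /andP[_ /eqP].
(* Off [R], [f] is the conjugate of [q] by [p], since [q] is controlled only on [R]. *)
pose f i := if i \in R then q i else p (q (p i)).
have pRN i : i \notin R -> p i \in R by rewrite pR.
have fR i : (f i \in R) = (i \in R).
  rewrite /f; case: (boolP (i \in R)) => iR; first by have [->] := qR i iR.
  by rewrite pR; have [-> _ _] := qR _ (pRN _ iR).
have fK : involutive f.
  move=> i; rewrite {1}/f fR /f; case: (boolP (i \in R)) => iR; first by have [_ _] := qR i iR.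
  by rewrite pK; have [_ _ ->] := qR _ (pRN _ iR); rewrite pK.
(* Commuting with [p] makes [p \o f] an involution; the opponents [f i] and [p (f i)] are joined by
   an edge, so their strengths average to the mean. *)
have fp i : f (p i) = p (f i).
  by rewrite /f pR; case: (boolP (i \in R)) => iR /=; rewrite pK.
apply: (@involutions_fair_draw f (p \o f)) => //= [i|i|i].
- by rewrite /= fp pK fK.
- rewrite /f; case: ifPn => iR; first by have [_ ->] := qR i iR.
  by have [_ + _] := qR _ (pRN _ iR); rewrite -(inj_eq (inv_inj pK)) pK.
by rewrite pR fR.
Qed.

End Pots.

Theorem theorem9 (T : finType) (n : nat) (s : T -> nat) (R B : {set T})
    (hT : #|T| = n) (hn : ~~ odd n) (hkn : 2 <= n - 1)
    (hRB : R :|: B = [set: T]) (hdisj : [disjoint R & B])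
    (hR : #|R| = n %/ 2) (hB : #|B| = n %/ 2) :
  (exists M : {set {set T}},
     [/\ is_draw 2 M, fair s M & one_match_per_pot R B M])
  <->
  (forall C : {set T}, C \in components (pot_graph s R B) ->
     has_perfect_matching (pot_graph s R B) C) /\ 4 %| n.
Proof.
have BE : B = ~: R.
  apply/setP=> i; have := in_setT i; rewrite -hRB !inE.
  case: (boolP (i \in R)) => //= iR _; exact: disjointFr hdisj iR.
have evR : (4 %| n) = ~~ odd #|R| by rewrite hR; lia.
rewrite BE evR (components_perfect_matchings (@card_pot_edge T s R)).
split=> [[M [_ fairM M1]]|[[p pK adj] ev]].
  by have [ev pm] := fair_draw_pot_matching fairM M1.
exact: pot_matching_fair_draw ev pK adj.
Qed.
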